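(* Let $\Omega$ be a semigroup with unit $1$, $(L,\mu,p)$ a Hom-associative algebra, $(V,\mu_l,\mu_r,q)$ a bimodule over it, $\Phi$ a 2-cocycle of $L$ with coefficients in $V$, and $\mathcal{R}=\{R_\alpha:V\to L\}_{\alpha\in\Omega}$ a $\Phi$-twisted Rota-Baxter family operator. Let $\mathcal{R}^t=\mathcal{R}+t\mathcal{R}^1$ and $\bar{\mathcal{R}}^t=\mathcal{R}+t\bar{\mathcal{R}}^1$ be two equivalent infinitesimal deformations of $\mathcal{R}$, where $\mathcal{R}^1=\{R^1_\alpha:V\to L\}_{\alpha\in\Omega}$ and $\bar{\mathcal{R}}^1=\{\bar R^1_\alpha:V\to L\}_{\alpha\in\Omega}$. Then $\mathcal{R}^1$ and $\bar{\mathcal{R}}^1$ define the same cohomology class in $H^1_R(V,L)$ (i.e. both are 1-cocycles and their difference lies in $B^1_R(V,L)$).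
   Context: Work over a field $\mathbb{K}$ of characteristic $0$. A Hom-associative algebra $(L,\mu,p)$ is a vector space $L$ with a linear map $p:L\to L$ and a bilinear product $\mu(x,y)=x\cdot y$ such that $p(x\cdot y)=p(x)\cdot p(y)$ and $p(x)\cdot(y\cdot z)=(x\cdot y)\cdot p(z)$. A bimodule $(V,\mu_l,\mu_r,q)$ over it is a vector space $V$ with a linear map $q:V\to V$ and bilinear maps $\mu_l:L\times V\to V$, $(x,u)\mapsto x\cdot_l u$, and $\mu_r:V\times L\to V$, $(u,x)\mapsto u\cdot_r x$, such that $q(x\cdot_l u)=p(x)\cdot_l q(u)$, $q(u\cdot_r x)=q(u)\cdot_r p(x)$, $q(u)\cdot_r(x\cdot y)=(u\cdot_r x)\cdot_r p(y)$, $p(x)\cdot_l(u\cdot_r y)=(x\cdot_l u)\cdot_r p(y)$, $p(x)\cdot_l(y\cdot_l u)=(x\cdot y)\cdot_l q(u)$. A 2-cocycle of $L$ with coefficients in $V$ is a bilinear map $\Phi:L\otimes L\to V$ with $q\,\Phi(x_1,x_2)=\Phi(p(x_1),p(x_2))$ and $p(x_1)\cdot_l\Phi(x_2,x_3)-\Phi(x_1,x_2)\cdot_r p(x_3)-\Phi(x_1\cdot x_2,p(x_3))+\Phi(p(x_1),x_2\cdot x_3)=0$. A $\Phi$-twisted Rota-Baxter family operator is a collection of linear maps $\{R_\alpha:V\to L\}_{\alpha\in\Omega}$ with $R_\alpha\circ q=p\circ R_\alpha$ and $R_\alpha u\cdot R_\beta v=R_{\alpha\beta}(R_\alpha u\cdot_l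 v+u\cdot_r R_\beta v+\Phi(R_\alpha u,R_\beta v))$ for all $u,v\in V$, $\alpha,\beta\in\Omega$. An infinitesimal deformation of $\mathcal{R}$ is a sum $\mathcal{R}^t=\mathcal{R}+t\mathcal{R}^1=\{R^t_\alpha=R_\alpha+tR^1_\alpha\}_{\alpha\in\Omega}$ that is a $\Phi$-twisted Rota-Baxter family operator (on the same $V$, $L$, with the same $\Phi$) for all $t\in\mathbb{K}$. Two infinitesimal deformations $\mathcal{R}^t,\bar{\mathcal{R}}^t$ of $\mathcal{R}$ are equivalent if there is $x\in L$ with $p(x)=x$ such that, for all $t$, the maps $\varphi^t:L\to L$, $\varphi^t(a)=a+t(x\cdot a-a\cdot x)$, and $\phi^t_\alpha:V\to V$, $\phi^t_\alpha(u)=u+t\big(x\cdot_l u-u\cdot_r x+\Phi(x,R_\alpha u)-\Phi(R_\alpha u,x)\big)$ ($\alpha\in\Omega$), form a morphism from $\mathcal{R}^t$ to $\bar{\mathcal{R}}^t$, i.e. $\varphi^t$ is a Hom-associative algebra homomorphism and for every $\alpha\in\Omega$: $\varphi^t\circ R^t_\alpha=\bar R^t_\alpha\circ\phi^t_\alpha$, $\phi^t_\alpha\circ q=q\circ\phi^t_\alpha$, $\phi^t_\alpha\circ\Phi=\Phi\circ(\varphi^t\otimes\varphi^t)$, $\phi^t_\alpha\circ\mu_l=\mu_l\circ(\varphi^t\otimes\phi^t_\alpha)$, $\phi^t_\alpha\circ\mu_r=\mu_r\circ(\phi^t_\alpha\otimes\varphi^t)$. Cohomology: $C^0_R(V,L)=\{x\in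 L\mid p(x)=x\}$; $C^1_R(V,L)$ is the space of families $f=\{f_\alpha\in\mathrm{Hom}(V,L)\}_{\alpha\in\Omega}$ with $p\circ f_\alpha=f_\alpha\circ q$. The differentials are $$(\delta^0_R(x))_\alpha(u)=R_\alpha u\cdot x-R_\alpha(u\cdot_r x)-R_\alpha\Phi(R_\alpha u,x)-x\cdot R_\alpha u+R_\alpha(x\cdot_l u)+R_\alpha\Phi(x,R_\alpha u),$$ $$(\delta^1_R f)_{\alpha,\beta}(u,v)=R_\alpha u\cdot f_\beta(v)-R_{\alpha\beta}(u\cdot_r f_\beta(v))-R_{\alpha\beta}\Phi(R_\alpha u,f_\beta(v))-f_{\alpha\beta}\big(R_\alpha u\cdot_l v+u\cdot_r R_\beta v+\Phi(R_\alpha u,R_\beta v)\big)+f_\alpha(u)\cdot R_\beta v-R_{\alpha\beta}(f_\alpha(u)\cdot_l v)-R_{\alpha\beta}\Phi(f_\alpha(u),R_\beta v).$$ $Z^1_R(V,L)=\ker\delta^1_R$ (1-cocycles), $B^1_R(V,L)=\delta^0_R(C^0_R(V,L))$ (1-coboundaries), $H^1_R(V,L)=Z^1_R(V,L)/B^1_R(V,L)$. *)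

(* Defs.v *)
From HB Require Import structures.
From mathcomp Require Import all_boot all_order all_algebra.

Set Implicit Arguments.
Unset Strict Implicit.
Unset Printing Implicit Defensive.

Import GRing.Theory.
Local Open Scope ring_scope.

Record homAssocAlg (K : fieldType) := HomAssocAlg {
  ha_sort :> lmodType K;
  ha_twist : {linear ha_sort -> ha_sort};
  ha_mul : {bilinear ha_sort -> ha_sort -> ha_sort};
  ha_twistM : forall x y,
    ha_twist (ha_mul x y) = ha_mul (ha_twist x) (ha_twist y);
  ha_homA : forall x y z,
    ha_mul (ha_twist x) (ha_mul y z) = ha_mul (ha_mul x y) (ha_twist z) }.

Arguments ha_twist {K h}.
Arguments ha_mul {K h}.

Notation "x ** y" := (ha_mul x y) (at level 40, left associativity) : ring_scope.

Record bimodule (K : fieldType) (L : homAssocAlg K) := Bimodule {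
  bm_sort :> lmodType K;
  bm_twist : {linear bm_sort -> bm_sort};
  bm_lact : {bilinear L -> bm_sort -> bm_sort};
  bm_ract : {bilinear bm_sort -> L -> bm_sort};
  bm_twist_lact : forall x u,
    bm_twist (bm_lact x u) = bm_lact (ha_twist x) (bm_twist u);
  bm_twist_ract : forall u x,
    bm_twist (bm_ract u x) = bm_ract (bm_twist u) (ha_twist x);
  bm_ractA : forall u x y,
    bm_ract (bm_twist u) (x ** y) = bm_ract (bm_ract u x) (ha_twist y);
  bm_lractA : forall x u y,
    bm_lact (ha_twist x) (bm_ract u y) = bm_ract (bm_lact x u) (ha_twist y);
  bm_lactA : forall x y u,
    bm_lact (ha_twist x) (bm_lact y u) = bm_lact (x ** y) (bm_twist u) }.

Arguments bm_twist {K L b}.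
Arguments bm_lact {K L b}.
Arguments bm_ract {K L b}.

Notation "x *> u" := (bm_lact x u) (at level 40, left associativity) : ring_scope.
Notation "u <* x" := (bm_ract u x) (at level 40, left associativity) : ring_scope.

Definition cocycle2 (K : fieldType) (L : homAssocAlg K) (V : bimodule L)
    (Phi : {bilinear L -> L -> V}) : Prop :=
  (forall x y : L, bm_twist (Phi x y) = Phi (ha_twist x) (ha_twist y)) /\
  (forall x y z : L,
     ha_twist x *> Phi y z - Phi x y <* ha_twist z
     - Phi (x ** y) (ha_twist z) + Phi (ha_twist x) (y ** z) = 0).

Definition twistedRBFamily (K : fieldType) (Omega : monoidType)
    (L : homAssocAlg K) (V : bimodule L) (Phi : {bilinear L -> L -> V})
    (R : Omega -> {linear V -> L}) : Prop :=
  (forall (a : Omega) (u : V), R a (bm_twist u) = ha_twist (R a u)) /\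
  (forall (a b : Omega) (u v : V),
     R a u ** R b v = R (a * b)%g (R a u *> v + u <* R b v + Phi (R a u) (R b v))).

Definition linDeform (K : fieldType) (Omega : monoidType) (V L : lmodType K)
    (R R1 : Omega -> {linear V -> L}) (t : K) : Omega -> {linear V -> L} :=
  fun a => R a \+ t \*: R1 a.

Definition infDeformation (K : fieldType) (Omega : monoidType)
    (L : homAssocAlg K) (V : bimodule L) (Phi : {bilinear L -> L -> V})
    (R R1 : Omega -> {linear V -> L}) : Prop :=
  forall t : K, twistedRBFamily Phi (linDeform R R1 t).

Definition homAssocMorphism (K : fieldType) (L L' : homAssocAlg K)
    (phi : {linear L -> L'}) : Prop :=
  (forall x y : L, phi (x ** y) = phi x ** phi y) /\
  (forall x : L, phi (ha_twist x) = ha_twist (phi x)).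

Definition RBFamilyMorphism (K : fieldType) (Omega : monoidType)
    (L : homAssocAlg K) (V : bimodule L) (Phi : {bilinear L -> L -> V})
    (R S : Omega -> {linear V -> L})
    (phi : {linear L -> L}) (psi : Omega -> {linear V -> V}) : Prop :=
  homAssocMorphism phi /\
  forall a : Omega,
  [/\ forall u : V, phi (R a u) = S a (psi a u),
      forall u : V, psi a (bm_twist u) = bm_twist (psi a u),
      forall x y : L, psi a (Phi x y) = Phi (phi x) (phi y),
      forall (x : L) (u : V), psi a (x *> u) = phi x *> psi a u
    & forall (u : V) (x : L), psi a (u <* x) = psi a u <* phi x].

Definition algDeform (K : fieldType) (L : homAssocAlg K) (x : L) (t : K)
    : {linear L -> L} :=
  idfun \+ t \*: (ha_mul x \- applyr ha_mul x).

Lemma algDeformE (K : fieldType) (L : homAssocAlg K) (x : L) (t : K) (y : L) :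
  algDeform x t y = y + t *: (x ** y - y ** x).
Proof. by []. Qed.

Definition modDeform (K : fieldType) (Omega : monoidType)
    (L : homAssocAlg K) (V : bimodule L) (Phi : {bilinear L -> L -> V})
    (R : Omega -> {linear V -> L}) (x : L) (t : K) : Omega -> {linear V -> V} :=
  fun a => idfun \+ t \*: (bm_lact x \- applyr bm_ract x
                           \+ (Phi x \o R a) \- (applyr Phi x \o R a)).

Lemma modDeformE (K : fieldType) (Omega : monoidType)
    (L : homAssocAlg K) (V : bimodule L) (Phi : {bilinear L -> L -> V})
    (R : Omega -> {linear V -> L}) (x : L) (t : K) (a : Omega) (u : V) :
  modDeform Phi R x t a u =
    u + t *: (x *> u - u <* x + Phi x (R a u) - Phi (R a u) x).
Proof. by []. Qed.

Definition equivDeformation (K : fieldType) (Omega : monoidType)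
    (L : homAssocAlg K) (V : bimodule L) (Phi : {bilinear L -> L -> V})
    (R R1 R1' : Omega -> {linear V -> L}) : Prop :=
  exists x : L, ha_twist x = x /\
    forall t : K,
      RBFamilyMorphism Phi (linDeform R R1 t) (linDeform R R1' t)
        (algDeform x t) (modDeform Phi R x t).

Definition cochain0 (K : fieldType) (L : homAssocAlg K) (x : L) : Prop :=
  ha_twist x = x.

Definition cochain1 (K : fieldType) (Omega : monoidType)
    (L : homAssocAlg K) (V : bimodule L) (f : Omega -> {linear V -> L}) : Prop :=
  forall (a : Omega) (u : V), ha_twist (f a u) = f a (bm_twist u).

Definition delta0 (K : fieldType) (Omega : monoidType)
    (L : homAssocAlg K) (V : bimodule L) (Phi : {bilinear L -> L -> V})
    (R : Omega -> {linear V -> L}) (x : L) (a : Omega) (u : V) : L :=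
  R a u ** x - R a (u <* x) - R a (Phi (R a u) x)
  - x ** R a u + R a (x *> u) + R a (Phi x (R a u)).

Definition delta1 (K : fieldType) (Omega : monoidType)
    (L : homAssocAlg K) (V : bimodule L) (Phi : {bilinear L -> L -> V})
    (R f : Omega -> {linear V -> L}) (a b : Omega) (u v : V) : L :=
  R a u ** f b v - R (a * b)%g (u <* f b v) - R (a * b)%g (Phi (R a u) (f b v))
  - f (a * b)%g (R a u *> v + u <* R b v + Phi (R a u) (R b v))
  + f a u ** R b v - R (a * b)%g (f a u *> v) - R (a * b)%g (Phi (f a u) (R b v)).

Definition cocycle1 (K : fieldType) (Omega : monoidType)
    (L : homAssocAlg K) (V : bimodule L) (Phi : {bilinear L -> L -> V})
    (R f : Omega -> {linear V -> L}) : Prop :=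
  cochain1 f /\
  forall (a b : Omega) (u v : V), delta1 Phi R f a b u v = 0.

Definition coboundary1 (K : fieldType) (Omega : monoidType)
    (L : homAssocAlg K) (V : bimodule L) (Phi : {bilinear L -> L -> V})
    (R f : Omega -> {linear V -> L}) : Prop :=
  exists x : L, cochain0 x /\
    forall (a : Omega) (u : V), f a u = delta0 Phi R x a u.

(* Equality of the classes of f and g in H^1 = Z^1 / B^1. *)
Definition sameClassH1 (K : fieldType) (Omega : monoidType)
    (L : homAssocAlg K) (V : bimodule L) (Phi : {bilinear L -> L -> V})
    (R f g : Omega -> {linear V -> L}) : Prop :=
  [/\ cocycle1 Phi R f, cocycle1 Phi R g
    & coboundary1 Phi R (fun a => f a \- g a : {linear V -> L})].

(* Main.v *)
(** Both the deformed Rota-Baxter identity and the intertwining relation are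
    polynomial identities in [t] with coefficients in [L].  As [K] is infinite,
    they hold coefficientwise; the coefficient of [t] in the first is the
    1-cocycle condition, in the second it is [R1 - R1' = delta0 x]. *)

Require Import Defs.
From HB Require Import structures.
From mathcomp Require Import all_boot all_order all_algebra.
Import GRing.Theory.
Local Open Scope ring_scope.

Set Implicit Arguments.
Unset Strict Implicit.
Unset Printing Implicit Defensive.

Lemma natr_inj_pchar0 (K : fieldType) (charK0 : [pchar K] =i pred0) :
  injective (fun n : nat => n%:R : K).
Proof.
have hle m n : (m <= n)%N -> m%:R = n%:R :> K -> m = n.
  move=> lemn /eqP; rewrite eq_sym -subr_eq0 -natrB //.
  rewrite ((pcharf0P K).1 charK0) subn_eq0 => lenm.
  by apply/eqP; rewrite eqn_leq lemn.
move=> m n /= e; case: (leqP m n) => [le|/ltnW le]; first exact: hle.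
by apply/esym/hle.
Qed.

(** In characteristic 0 the nodes [0, ..., n-1] are distinct in [K], so their Vandermonde matrix is
    invertible. Each coefficient is then a fixed [K]-linear combination of the values at these
    nodes, which makes sense in any [K]-module [M]. *)
Lemma polyfun_coef_inj (K : fieldType) (charK0 : [pchar K] =i pred0)
    (M : lmodType K) (n : nat) (c d : 'I_n -> M) :
  (forall t : K, \sum_(i < n) t ^+ i *: c i = \sum_(i < n) t ^+ i *: d i) ->
  c =1 d.
Proof.
move=> h k; pose V := Vandermonde n (\row_(j < n) j%:R : 'rV[K]_n).
have uV : V \in unitmx.
  rewrite unitmxE det_Vandermonde unitfE.
  apply/prodf_neq0 => i _; apply/prodf_neq0 => j ltij.
  rewrite !mxE subr_eq0; apply: contraTneq ltij => /(natr_inj_pchar0 charK0) ->.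
  by rewrite ltnn.
(* Column [k] of the inverse matrix gives interpolation weights that annihilate every monomial of
   degree below [n] except [t ^+ k]. *)
have dual (i : 'I_n) :
    \sum_(j < n) j%:R ^+ i * invmx V j k = (i == k)%:R :> K.
  have /matrixP/(_ i k) := mulmxV uV; rewrite mxE [RHS]mxE => <-.
  by apply: eq_bigr => j _; rewrite !mxE.
have recover (e : 'I_n -> M) :
    e k = \sum_(j < n) invmx V j k *: \sum_(i < n) j%:R ^+ i *: e i.
  under eq_bigr do rewrite scaler_sumr.
  rewrite exchange_big /=.
  under eq_bigr do under eq_bigr do rewrite scalerA mulrC.
  under eq_bigr do rewrite -scaler_suml dual.
  rewrite (bigD1 k) //= eqxx scale1r big1 ?addr0 // => i neik.
  by rewrite (negPf neik) scale0r.
by rewrite (recover c) (recover d); apply: eq_bigr => j _; rewrite h.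
Qed.

(** Degree 3 is what the deformed Rota-Baxter identity reaches, through [R1] applied to
    [Phi (R1 a u) (R1 b v)]. The nested Horner form matches the expansions produced by
    [linear_affine] and [bilinear_affine]. *)
Lemma cubic_coef1_inj (K : fieldType) (charK0 : [pchar K] =i pred0)
    (M : lmodType K) (c0 c1 c2 c3 d0 d1 d2 d3 : M) :
  (forall t : K, c0 + t *: (c1 + t *: (c2 + t *: c3))
               = d0 + t *: (d1 + t *: (d2 + t *: d3))) ->
  c1 = d1.
Proof.
move=> h; pose s (e0 e1 e2 e3 : M) (i : 'I_4) := [:: e0; e1; e2; e3]`_i.
have horner e0 e1 e2 e3 t :
    \sum_(i < 4) t ^+ i *: s e0 e1 e2 e3 i
    = e0 + t *: (e1 + t *: (e2 + t *: e3)).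
  rewrite !big_ord_recl big_ord0 /s /= expr0 scale1r addr0 !scalerDr !scalerA.
  by rewrite expr1 expr2 !exprS expr0 mulr1 mulrA.
have eqs : s c0 c1 c2 c3 =1 s d0 d1 d2 d3.
  by apply: (polyfun_coef_inj charK0) => t; rewrite !horner.
exact: (eqs (Ordinal (isT : (1 < 4)%N))).
Qed.

Lemma linear_affine (K : fieldType) (A B : lmodType K) (f : {linear A -> B})
    (a a1 : A) (t : K) :
  f (a + t *: a1) = f a + t *: f a1.
Proof. by rewrite linearD linearZ. Qed.

Lemma bilinear_affine (K : fieldType) (A B C : lmodType K)
    (f : {bilinear A -> B -> C}) (a a1 : A) (b b1 : B) (t : K) :
  f (a + t *: a1) (b + t *: b1)
  = f a b + t *: (f a1 b + f a b1 + t *: f a1 b1).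
Proof.
by rewrite linearDl !linearDr !linearZl_LR !linearZr_LR /= !scalerDr !addrA
           (ACl (1*3*2*4)%AC).
Qed.

Section FirstOrder.
Variables (K : fieldType) (charK0 : [pchar K] =i pred0).
Variables (Omega : monoidType) (L : homAssocAlg K) (V : bimodule L).
Variables (Phi : {bilinear L -> L -> V}) (R : Omega -> {linear V -> L}).
Hypothesis hR : twistedRBFamily Phi R.

Lemma infDeformation_cocycle1 (R1 : Omega -> {linear V -> L}) :
  infDeformation Phi R R1 -> cocycle1 Phi R R1.
Proof.
move=> hR1; split=> [a u|a b u v].
  (* Compatibility with the twists is affine in [t], so comparing [t = 1] with the undeformed family
     isolates [R1]. *)
  have [/(_ a u) h _] := hR1 1; have [/(_ a u) h0 _] := hR.
  move: h; rewrite /linDeform /= !scale1r linearD /= h0.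
  by move/addrI ->.
(* [E0 + t E1 + t^2 E2] is the argument of the deformed operator at [a * b] on the right of the
   Rota-Baxter identity. *)
pose E0 := R a u *> v + u <* R b v + Phi (R a u) (R b v).
pose E1 := R1 a u *> v + u <* R1 b v
           + (Phi (R1 a u) (R b v) + Phi (R a u) (R1 b v)).
pose E2 := Phi (R1 a u) (R1 b v).
have key : R1 a u ** R b v + R a u ** R1 b v
           = R (a * b)%g E1 + R1 (a * b)%g E0.
  (* The left side is only quadratic in [t], hence the padding [0] as its cubic coefficient. *)
  apply: (@cubic_coef1_inj _ charK0 _
    (R a u ** R b v) _ (R1 a u ** R1 b v) 0
    (R (a * b)%g E0) _ (R (a * b)%g E2 + R1 (a * b)%g E1)
    (R1 (a * b)%g E2)) => t.
  have [_ /(_ a b u v)] := hR1 t.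
  rewrite /linDeform /= !bilinear_affine scaler0 addr0 => ->.
  have -> : (R a u + t *: R1 a u) *> v + u <* (R b v + t *: R1 b v)
       + (Phi (R a u) (R b v)
            + t *: (Phi (R1 a u) (R b v) + Phi (R a u) (R1 b v)
                    + t *: Phi (R1 a u) (R1 b v)))
       = E0 + t *: (E1 + t *: E2).
    rewrite linearDl linearDr linearZl_LR linearZr_LR /= /E0 /E1.
    by rewrite !scalerDr !addrA (ACl (1*3*5*2*4*6*7*8)%AC).
  rewrite !linear_affine /= !scalerDr !addrA.
  by rewrite (ACl (1*2*4*3*5*6)%AC).
have -> : delta1 Phi R R1 a b u v
   = R1 a u ** R b v + R a u ** R1 b v - (R (a * b)%g E1 + R1 (a * b)%g E0).
  rewrite /delta1 -/E0 /E1 !(linearD (R _)) /= !opprD !addrA.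
  by rewrite (ACl (5*1*6*2*7*3*4)%AC).
by rewrite key subrr.
Qed.

Lemma equivDeformation_coboundary1 (R1 R1' : Omega -> {linear V -> L}) :
  equivDeformation Phi R R1 R1' ->
  coboundary1 Phi R (fun a => R1 a \- R1' a : {linear V -> L}).
Proof.
case=> x [px h]; exists x; split=> // a u.
(* [D] is the first-order part of [modDeform] at [u]; the intertwining relation then reads
   [algDeform x t (R a u + t R1 a u) = (R a + t R1' a) (u + t D)], quadratic in [t] on both
   sides. *)
pose D := x *> u - u <* x + Phi x (R a u) - Phi (R a u) x.
have key : R1 a u + (x ** R a u - R a u ** x) = R a D + R1' a u.
  apply: (@cubic_coef1_inj _ charK0 _ (R a u) _ (x ** R1 a u - R1 a u ** x) 0
    (R a u) _ (R1' a D) 0) => t.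
  have [_ /(_ a) [/(_ u) e _ _ _ _]] := h t.
  have {e} : algDeform x t (R a u + t *: R1 a u)
             = R a (u + t *: D) + t *: R1' a (u + t *: D) := e.
  rewrite (linear_affine (algDeform x t)) (linear_affine (R a)).
  rewrite (linear_affine (R1' a)) !algDeformE.
  rewrite !scaler0 !addr0 !scalerDr !addrA => e.
  by rewrite (ACl (1*3*4*2*5*6)%AC) /=.
have /= -> : (R1 a \- R1' a) u = R a D - (x ** R a u - R a u ** x).
  by rewrite /= -[R1 a u](addrK (x ** R a u - R a u ** x)) key addrAC addrK.
rewrite /D !(linearD (R a)) !(linearN (R a)) /= opprB /delta0 !addrA.
by rewrite (ACl (5*2*4*6*1*3)%AC).
Qed.

End FirstOrder.

Theorem theorem5p5 (K : fieldType) (charK0 : [pchar K] =i pred0)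
    (Omega : monoidType) (L : homAssocAlg K) (V : bimodule L)
    (Phi : {bilinear L -> L -> V}) (hPhi : cocycle2 Phi)
    (R : Omega -> {linear V -> L}) (hR : twistedRBFamily Phi R)
    (R1 R1' : Omega -> {linear V -> L})
    (hR1 : infDeformation Phi R R1) (hR1' : infDeformation Phi R R1')
    (hequiv : equivDeformation Phi R R1 R1') :
  sameClassH1 Phi R R1 R1'.
Proof.
split; [exact: infDeformation_cocycle1 | exact: infDeformation_cocycle1 |].
exact: equivDeformation_coboundary1.
Qed.
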